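(* Let $\mathcal{H}$ be an infinite-dimensional separable real or complex Hilbert space and let $A$ be a positive bounded operator on $\mathcal{H}$ with $\|A\|_{ess}>1$. Then $A$ has a projection decomposition.
   Context: For a bounded operator $B$ on $\mathcal{H}$, the essential norm is $\|B\|_{ess}=\inf\{\|B-K\| : K \text{ compact operator on } \mathcal{H}\}$. A positive operator $A$ has a projection decomposition if $A$ can be written as the sum of a finite or infinite sequence of (not necessarily mutually orthogonal) self-adjoint (orthogonal) projections, with the series converging in the strong operator topology. $A$ is not assumed invertible. *)

(* Defs.v *)
From mathcomp Require Import all_boot all_algebra all_classical all_reals all_analysis.
From mathcomp Require Import complex.
Import GRing.Theory Num.Theory numFieldNormedType.Exports.
Set Implicit Arguments. Unset Strict Implicit. Unset Printing Implicit Defensive.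
Local Open Scope classical_set_scope.
Local Open Scope ring_scope.

(* Generic setting: scalar field K (R or R[i]), with conjugation [cj]
   (identity on R, complex conjugation on R[i]) and the embedding [emb]
   of the reals into K (used to read off real values of norms).
   V is a complete normed space over K; its norm must come from [ip]. *)

Section Hilbert.
Variables (R : realType) (K : numFieldType) (emb : R -> K) (cj : K -> K).
Variable V : completeNormedModType K.

(* [ip] is an inner product (linear in the first variable, conjugate
   symmetric) inducing the norm of V: ||x||^2 = <x,x>.  Together with the
   completeness of V this makes (V, ip) a Hilbert space over K. *)
Definition inner_product (ip : V -> V -> K) : Prop :=
  [/\ forall (a : K) (x y z : V), ip (a *: x + y) z = a * ip x z + ip y z,
      forall x y : V, ip x y = cj (ip y x) &
      forall x : V, `|x| ^+ 2 = ip x x].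

Definition separable : Prop :=
  exists f : nat -> V, closure (range f) = setT.

Definition infinite_dimensional : Prop :=
  ~ exists (n : nat) (v : 'I_n -> V),
      forall x : V, exists c : 'I_n -> K, x = \sum_(i < n) c i *: v i.

Definition bounded_op (T : {linear V -> V}) : Prop :=
  exists M : K, forall x : V, `|T x| <= M * `|x|.

Definition opnorm (B : V -> V) : R :=
  sup [set r : R | exists x : V, `|x| <= 1 /\ emb r = `|B x|].

Definition compact_op (T : {linear V -> V}) : Prop :=
  compact (closure (T @` [set x : V | `|x| <= 1])).

Definition essnorm (B : {linear V -> V}) : R :=
  inf [set opnorm (fun x => B x - T x) | T in [set T : {linear V -> V} | compact_op T]].

Definition self_adjoint (ip : V -> V -> K) (T : V -> V) : Prop :=
  forall x y : V, ip (T x) y = ip x (T y).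

Definition positive_op (ip : V -> V -> K) (T : {linear V -> V}) : Prop :=
  self_adjoint ip T /\ forall x : V, 0 <= ip (T x) x.

Definition orth_projection (ip : V -> V -> K) (P : {linear V -> V}) : Prop :=
  self_adjoint ip P /\ forall x : V, P (P x) = P x.

Definition projection_decomposition (ip : V -> V -> K) (A : {linear V -> V}) : Prop :=
  (exists (n : nat) (P : 'I_n -> {linear V -> V}),
      (forall i, orth_projection ip (P i)) /\
      forall x : V, A x = \sum_(i < n) P i x)
  \/
  (exists P : nat -> {linear V -> V},
      (forall i, orth_projection ip (P i)) /\
      forall x : V, (fun n : nat => \sum_(i < n) P i x) @ \oo --> A x).

Definition theorem2_for : Prop :=
  forall (ip : V -> V -> K),
    inner_product ip -> separable -> infinite_dimensional ->
    forall A : {linear V -> V},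
      bounded_op A -> positive_op ip A -> 1 < essnorm A ->
      projection_decomposition ip A.

End Hilbert.

Definition real_to_complex (R : realType) (r : R) : R[i] := Complex r 0.

(* Main.v *)
(** Rank-one projections are subtracted from [A] one at a time.  Let [B >= 0] be
    what is left and [x] a vector.  If [<Bv, v> <= |Bv|^2], then subtracting the
    projection [P] onto [Bv] leaves [B - P >= 0], by Cauchy-Schwarz for the form of
    [B].  When [<Bx, x> <= |Bx|^2] take [v = x]; otherwise take [v = x + t y] with
    [y] orthogonal to [Bx] and [B (B x)], [|By| > c |y|] for some [c > 1], and [t]
    such that [<Bv, v> = |Bv|^2].  Such a [y] exists because the essential norm
    exceeds [c], hence so does the norm of [A] on every subspace of finite
    codimension.  In both cases [<(B - P) x, x> <= q <Bx, x>] with [q < 1]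
    independent of the stage.  Treating each vector of a dense sequence infinitely
    often, the remainders tend strongly to [0]. *)
From HB Require Import structures.
Require Import Defs.
From mathcomp Require Import all_boot all_algebra all_classical all_reals all_analysis.
From mathcomp Require Import complex.
From mathcomp Require Import all_order ring lra.
Import Order.TTheory GRing.Theory Num.Theory numFieldNormedType.Exports.
Local Open Scope ring_scope.
Local Open Scope classical_set_scope.

(** * Scalars: order, square roots and geometric decay *)

Section Scalars.
Variables (R : realType) (K : numFieldType).
Variables (emb : {rmorphism R -> K}) (cj : {rmorphism K -> K}).
Hypothesis emb_le : {mono emb : r s / r <= s}.
Hypothesis emb_onto : forall a : K, 0 <= a -> exists r, emb r = a.
Hypothesis cjE : forall a : K, a * cj a = `|a| ^+ 2.
(* Makes closed discs of [K] images of compact real rectangles: [i] is [0] for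
   [K = R] and the imaginary unit for [K = R[i]]. *)
Hypothesis emb_span : exists i : K, forall (M : R) (a : K), `|a| <= emb M ->
  exists r s : R, [/\ `|r| <= M, `|s| <= M & a = emb r + emb s * i].

Lemma cj_id (a : K) : 0 <= a -> cj a = a.
Proof.
move=> a0; have [->|an0] := eqVneq a 0; first by rewrite rmorph0.
by apply: (mulfI an0); rewrite cjE ger0_norm// expr2.
Qed.

Lemma emb_lt : {mono emb : r s / r < s}.
Proof. exact: leW_mono. Qed.

Lemma emb_ge0 (r : R) : (0 <= emb r) = (0 <= r).
Proof. by rewrite -[in LHS](rmorph0 emb) emb_le. Qed.

Lemma emb_gt0 (r : R) : (0 < emb r) = (0 < r).
Proof. by rewrite -[in LHS](rmorph0 emb) emb_lt. Qed.

Lemma emb_norm (r : R) : `|emb r| = emb `|r|.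
Proof.
have [r0|/ltW r0] := leP 0 r.
  by rewrite !ger0_norm ?emb_ge0.
by rewrite ler0_norm ?ler0_norm ?rmorphN// -oppr_ge0 -rmorphN emb_ge0 oppr_ge0.
Qed.

Lemma scalar_sqrt (a : K) : 0 <= a -> exists2 t : K, 0 <= t & t ^+ 2 = a.
Proof.
move=> a0; have [r ra] := emb_onto _ a0.
move: a0; rewrite -ra emb_ge0 => r0.
exists (emb (Num.sqrt r)); first by rewrite emb_ge0 sqrtr_ge0.
by rewrite -rmorphXn sqr_sqrtr.
Qed.

Lemma scalar_expr_small (q e : K) : 0 <= q < 1 -> 0 < e -> exists k, q ^+ k < e.
Proof.
move=> /andP[q0 q1] e0; have [r rq] := emb_onto _ q0; have [d de] := emb_onto _ (ltW e0).
move: q0 q1 e0; rewrite -rq -de emb_ge0 emb_gt0 -[1](rmorph1 emb) !emb_lt.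
move=> r0 r1 d0; have r1' : `|r| < 1 by rewrite ger0_norm.
have /cvgrPdist_lt /(_ _ d0)[N _ /(_ N (leqnn N))] := cvg_expr r1'.
rewrite /= sub0r normrN ger0_norm ?exprn_ge0// => rd.
by exists N; rewrite -rmorphXn emb_lt.
Qed.

(** * Linear maps and compact sets in [V] *)

Variable V : completeNormedModType K.

Lemma linear_pack (f : V -> V) : linear f -> exists g : {linear V -> V}, forall x, g x = f x.
Proof.
move=> lf; pose m := GRing.isLinear.Build K V V *:%R f lf.
pose g : {linear V -> V} := HB.pack f m.
by exists g.
Qed.

Lemma emb_scale_continuous (w : V) : continuous (fun r : R => emb r *: w).
Proof.
move=> r; apply/cvgrPdist_lt => e e0.
have w1 : 0 < `|w| + 1 by rewrite ltr_wpDl.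
have [d de] := emb_onto _ (ltW (divr_gt0 e0 w1)).
have d0 : 0 < d by rewrite -emb_gt0 de divr_gt0.
near=> s.
rewrite -scalerBl normrZ -rmorphB emb_norm.
have : emb `|r - s| < e / (`|w| + 1).
  rewrite -de emb_lt; near: s.
  exact: (@nbhsx_ballx R R).
rewrite ltr_pdivlMr// => /le_lt_trans; apply.
by rewrite ler_wpM2l ?lerDl// emb_ge0.
Unshelve. all: by end_near. Qed.

Lemma compactD (S T : set V) : compact S -> compact T ->
  compact [set p.1 + p.2 | p in S `*` T].
Proof.
move=> cS cT; apply: continuous_compact; last exact: compact_setX.
by apply/continuous_subspaceT => p; exact: add_continuous.
Qed.

(** A rank-one map sends the unit ball into such a set, which makes finite-rank maps compact. By
    [emb_span] the multiples of [w] lie in the sum of two compact segments, along [w] and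
    [i *: w]. *)
Lemma scaled_disc_compact (M : K) (w : V) : 0 <= M ->
  exists2 S : set V, compact S & forall a : K, `|a| <= M -> S (a *: w).
Proof.
move=> /emb_onto[m <-]; have [i hi] := emb_span.
have cI (u : V) : compact [set (emb r *: u : V) | r in `[- m, m]].
  apply: continuous_compact; last exact: segment_compact.
  by apply: continuous_subspaceT; exact: emb_scale_continuous.
exists [set p.1 + p.2 | p in [set emb r *: w | r in `[- m, m]] `*`
                           [set emb r *: (i *: w) | r in `[- m, m]]].
  exact: compactD.
move=> a /hi[r [s [rm sm ->]]]; exists (emb r *: w, emb s *: (i *: w)) => /=.
  by split; [exists r | exists s]; rewrite //= in_itv/= -ler_norml.
by rewrite scalerDl scalerA.
Qed.

(** * Inner product and Cauchy-Schwarz inequalities *)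

Variable ip : V -> V -> K.
Hypothesis ipP : inner_product cj ip.

Lemma ipC x y : ip x y = cj (ip y x).
Proof. by case: ipP. Qed.

Lemma ipxx x : ip x x = `|x| ^+ 2.
Proof. by case: ipP. Qed.

Lemma ipDl x y z : ip (x + y) z = ip x z + ip y z.
Proof. by have [+ _ _] := ipP; move=> /(_ 1 x y z); rewrite scale1r mul1r. Qed.

Lemma ip0l z : ip 0 z = 0.
Proof. by apply: (addrI (ip 0 z)); rewrite -ipDl !addr0. Qed.

Lemma ipZl a x z : ip (a *: x) z = a * ip x z.
Proof. by have [+ _ _] := ipP; move=> /(_ a x 0 z); rewrite !addr0 ip0l addr0. Qed.

Lemma ipBl x y z : ip (x - y) z = ip x z - ip y z.
Proof. by rewrite ipDl -scaleN1r ipZl mulN1r. Qed.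

Lemma ipDr x y z : ip z (x + y) = ip z x + ip z y.
Proof. by rewrite ipC ipDl rmorphD -!ipC. Qed.

Lemma ip0r z : ip z 0 = 0.
Proof. by rewrite ipC ip0l rmorph0. Qed.

Lemma ipZr a x z : ip z (a *: x) = cj a * ip z x.
Proof. by rewrite ipC ipZl rmorphM -ipC. Qed.

Lemma ipBr x y z : ip z (x - y) = ip z x - ip z y.
Proof. by rewrite ipC ipBl rmorphB -!ipC. Qed.

Definition ipE := (ipBl, ipDl, ipBr, ipDr, ipZl, ipZr).

Lemma ip_orth_sym x y : ip x y = 0 -> ip y x = 0.
Proof. by move=> xy; rewrite ipC xy rmorph0. Qed.

Lemma ipM_sym x y : ip x y * ip y x = `|ip x y| ^+ 2.
Proof. by rewrite [ip y x]ipC cjE. Qed.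

(** The form is nonnegative at [t x - s y]; taking [t = b], [s = c] gives [b (a b - |c|^2) >= 0].
    When [b = 0], taking [t = 1] and for [s] a large multiple of [c] forces [c = 0]. *)
Lemma positive_cauchy_schwarz (B : {linear V -> V}) x y : positive_op ip B ->
  `|ip (B x) y| ^+ 2 <= ip (B x) x * ip (B y) y.
Proof.
move=> [Bsa Bpos].
set a := ip (B x) x; set b := ip (B y) y; set c := ip (B x) y.
have a0 : 0 <= a by exact: Bpos.
have b0 : 0 <= b by exact: Bpos.
have cE : ip (B y) x = cj c by rewrite Bsa ipC.
have quad s t : 0 <= t ->
    0 <= t ^+ 2 * a - t * (cj s * c) - t * (s * cj c) + s * cj s * b.
  move=> t0; suff <- : ip (B (t *: x - s *: y)) (t *: x - s *: y) =
    t ^+ 2 * a - t * (cj s * c) - t * (s * cj c) + s * cj s * b by exact: Bpos.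
  by rewrite linearB 2![in LHS]linearZ/= !ipE cE -/a -/b -/c (cj_id _ t0); ring.
have [b00|bn0] := eqVneq b 0.
  rewrite b00 mulr0; have [->|cn0] := eqVneq c 0; first by rewrite normr0 expr0n.
  have c0 : 0 < `|c| ^+ 2 by rewrite exprn_gt0 ?normr_gt0.
  pose r := (a + 1) / `|c| ^+ 2.
  have rr : cj r = r by apply: cj_id; rewrite divr_ge0 ?addr_ge0 ?exprn_ge0.
  have rc : r * (c * cj c) = a + 1 by rewrite cjE /r divfK ?gt_eqF.
  have := quad (r * c) 1 ler01; rewrite b00 rmorphM rr.
  have -> : 1 ^+ 2 * a - 1 * (r * cj c * c) - 1 * (r * c * cj c) + r * c * (r * cj c) * 0
      = a - 2 * (r * (c * cj c)) by ring.
  have -> : a - 2 * (r * (c * cj c)) = - (a + 2) by rewrite rc; ring.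
  by rewrite oppr_ge0 lt_geF ?ltr_wpDl.
have bp : 0 < b by rewrite lt_def bn0.
have := quad c b b0.
have -> : b ^+ 2 * a - b * (cj c * c) - b * (c * cj c) + c * cj c * b
    = b * (a * b - `|c| ^+ 2) by rewrite -cjE; ring.
by rewrite pmulr_rge0// subr_ge0.
Qed.

Lemma cauchy_schwarz x y : `|ip x y| <= `|x| * `|y|.
Proof.
have idp : positive_op ip (idfun : {linear V -> V}).
  by split=> // z; rewrite ipxx exprn_ge0.
have := positive_cauchy_schwarz (idfun : {linear V -> V}) x y idp.
by rewrite /= !ipxx -exprMn ler_pXn2r// nnegrE ?mulr_ge0.
Qed.

(** * Projections onto lines *)

(* For [u = 0] the division by [0] makes this the zero map, still a projection. *)
Definition line_proj u x := (ip x u / ip u u) *: u.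

Lemma ip_line_proj u x : ip (line_proj u x) x = `|ip x u| ^+ 2 / `|u| ^+ 2.
Proof. by rewrite ipZl -ipxx -ipM_sym mulrAC. Qed.

Lemma cj_ipxxV u : cj (ip u u)^-1 = (ip u u)^-1.
Proof. by apply: cj_id; rewrite invr_ge0 ipxx exprn_ge0. Qed.

Lemma line_proj_orth u :
  exists2 P : {linear V -> V}, P =1 line_proj u & orth_projection ip P.
Proof.
have [P PE] : exists P : {linear V -> V}, P =1 line_proj u.
  apply: linear_pack => a x y.
  by rewrite /line_proj ipDl ipZl mulrDl scalerDl scalerA mulrA.
exists P => //; split=> [x y|x]; rewrite !PE /line_proj.
  by rewrite !ipE rmorphM cj_ipxxV -ipC; ring.
have [->|u0] := eqVneq u 0; first by rewrite !scaler0.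
by rewrite ipZl divfK// ipxx expf_eq0/= normr_eq0.
Qed.

(** * Removing one rank-one projection *)

(* [adm_large] expresses that the essential norm exceeds [c] in a form that
   obviously survives the subtraction of a rank-one operator. *)
Record admissible (M c : K) (B : {linear V -> V}) : Prop := Admissible {
  adm_pos : positive_op ip B;
  adm_bound : forall x, ip (B x) x <= M * `|x| ^+ 2;
  adm_large : forall s : seq V, exists2 y,
    (forall u, u \in s -> ip y u = 0) & c * `|y| < `|B y| }.

(** Cauchy-Schwarz for the form of [B] at [x] and [B x], with [adm_bound] at [B x], gives the claim
    times [|Bx|^2]. It turns decay of [<Bx, x>] into decay of [|Bx|]. *)
Lemma adm_norm M c B x : 0 <= M -> admissible M c B -> `|B x| ^+ 2 <= M * ip (B x) x.
Proof.
move=> M0 [Bp Bb _]; have [Bx0|Bx0] := eqVneq (B x) 0.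
  by rewrite Bx0 normr0 ip0l expr0n mulr0.
have n0 : 0 < `|B x| ^+ 2 by rewrite exprn_gt0 ?normr_gt0.
rewrite -(ler_pM2r n0) -[leLHS]expr2.
have := positive_cauchy_schwarz _ x (B x) Bp; rewrite ipxx ger0_norm ?exprn_ge0//.
move/le_trans; apply; rewrite [M * _]mulrC -mulrA ler_wpM2l//; exact: Bp.2.
Qed.

Lemma adm_lipschitz M c B x : 0 <= M -> admissible M c B -> `|B x| <= M * `|x|.
Proof.
move=> M0 adm; rewrite -(@ler_pXn2r _ 2)// ?nnegrE ?mulr_ge0//.
apply: le_trans (adm_norm _ _ _ x M0 adm) _.
by rewrite exprMn [M ^+ 2]expr2 -mulrA ler_wpM2l//; exact: adm_bound adm x.
Qed.

(* By Cauchy-Schwarz for the form of [B], subtracting from [B] the projection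
   onto [B v] preserves positivity as soon as [<Bv, v> <= |Bv|^2]. *)
Lemma admissible_sub M c (B P B' : {linear V -> V}) v :
  admissible M c B -> ip (B v) v <= `|B v| ^+ 2 ->
  P =1 line_proj (B v) -> orth_projection ip P ->
  (forall x, B' x = B x - P x) -> admissible M c B'.
Proof.
move=> [[Bsa Bpos] Bb Bl] hv PE [Psa _] B'E.
have valE x : ip (B' x) x = ip (B x) x - `|ip (B x) v| ^+ 2 / `|B v| ^+ 2.
  by rewrite B'E ipBl PE ip_line_proj -(Bsa x v).
split.
- split=> [x y|x]; first by rewrite !B'E ipBl ipBr Bsa Psa.
  rewrite valE subr_ge0; have [Bv0|Bv0] := eqVneq (B v) 0.
    by rewrite Bv0 normr0 expr0n invr0 mulr0.
  rewrite ler_pdivrMr ?exprn_gt0 ?normr_gt0//.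
  apply: le_trans (positive_cauchy_schwarz _ x v (conj Bsa Bpos)) _.
  by rewrite ler_wpM2l.
- move=> x; rewrite valE; apply: le_trans (Bb x).
  by rewrite lerBlDr lerDl divr_ge0 ?exprn_ge0.
- move=> s; have [y ys yl] := Bl (B v :: s).
  exists y => [u us|]; first by rewrite ys// inE us orbT.
  by rewrite B'E PE /line_proj ys ?mem_head// mul0r scale0r subr0.
Qed.

(** Projecting onto [B v] lowers [<Bx, x>] by [|<Bx, v>|^2 / |Bv|^2], so the second condition makes
    the loss at least the share [d]. The third covers [B v = 0], where the projection is zero. *)
Lemma exists_direction M c d B x : 1 < c -> 1 <= M -> 0 <= d -> d * M <= 1 ->
  d * c <= c - 1 -> admissible M c B ->
  exists v, [/\ ip (B v) v <= `|B v| ^+ 2,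
    d * ip (B x) x * `|B v| ^+ 2 <= `|ip (B x) v| ^+ 2 &
    B v = 0 -> ip (B x) x = 0].
Proof.
move=> c1 M1 d0 dM dc adm.
have c0 : 0 < c by exact: lt_trans c1.
have M0 : 0 <= M by exact: le_trans M1.
have [Bsa Bpos] := adm_pos _ _ _ adm.
set a := ip (B x) x; set b := `|B x| ^+ 2.
have a0 : 0 <= a by exact: Bpos.
have b0 : 0 <= b by rewrite exprn_ge0.
have [ab|ba] := real_leP (ger0_real a0) (ger0_real b0).
  exists x; split=> // [|Bx0]; last by rewrite /a Bx0 ip0l.
  rewrite (ger0_norm a0) expr2 mulrAC ler_wpM2r//.
  apply: le_trans (_ : d * (M * a) <= a); first by rewrite ler_wpM2l// (adm_norm _ _ _ _ M0 adm).
  by rewrite mulrA ler_piMl.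
(* These two orthogonality conditions kill the cross terms of [<Bv, v>] and of [|Bv|^2] for
   [v = x + t y]. *)
have [y ys yl] := adm_large _ _ _ adm [:: B x; B (B x)].
have yx : ip y (B x) = 0 by rewrite ys// mem_head.
have yxx : ip y (B (B x)) = 0 by rewrite ys// !inE eqxx orbT.
set h := `|B y| ^+ 2; set g := ip (B y) y.
have g0 : 0 <= g by exact: Bpos.
have h0 : 0 < h by rewrite exprn_gt0// (le_lt_trans _ yl)// mulr_ge0// ltW.
have cg : c * g <= h.
  have gn : g <= `|B y| * `|y| by rewrite -(ger0_norm g0) cauchy_schwarz.
  apply: le_trans (_ : c * (`|B y| * `|y|) <= _); first by rewrite ler_wpM2l// ltW.
  by rewrite mulrCA /h expr2 ler_wpM2l// ltW.
have gh : g < h.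
  have [->//|gn0] := eqVneq g 0; apply: lt_le_trans cg.
  by rewrite ltr_pMl// lt_def gn0.
have hg : 0 < h - g by rewrite subr_gt0.
(* This [t] solves [a + t^2 g = b + t^2 h], that is [<Bv, v> = |Bv|^2]. *)
have [t t0 tE] : exists2 t, 0 <= t & t ^+ 2 = (a - b) / (h - g).
  by apply: scalar_sqrt; rewrite divr_ge0// ltW// subr_gt0.
have tE' : t ^+ 2 * (h - g) = a - b by rewrite tE divfK// gt_eqF.
have formE : ip (B (x + t *: y)) (x + t *: y) = a + t ^+ 2 * g.
  rewrite linearD linearZ/= !ipE (Bsa y x) yx (Bsa x y) (ip_orth_sym (B y) x)//; last by rewrite Bsa.
  by rewrite (cj_id _ t0) -/a -/g; ring.
have normE : `|B (x + t *: y)| ^+ 2 = a + t ^+ 2 * g.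
  rewrite -ipxx linearD linearZ/= !ipE !ipxx (Bsa y) yxx (ip_orth_sym (B y) (B x)) ?Bsa//.
  rewrite (cj_id _ t0) -/b -/h.
  have -> : a = b + t ^+ 2 * (h - g) by rewrite tE'; ring.
  by ring.
have tg0 : 0 <= t ^+ 2 * g by rewrite mulr_ge0 ?exprn_ge0.
exists (x + t *: y); rewrite normE formE; split=> //.
- have -> : ip (B x) (x + t *: y) = a.
    by rewrite !ipE (ip_orth_sym y (B x) yx) mulr0 addr0.
  (* What remains is [d (a + t^2 g) <= a]. Multiplied by [c], and with [d c <= c - 1], it follows
     from [t^2 (c - 1) g <= t^2 (h - g) = a - b]. *)
  rewrite (ger0_norm a0) expr2 mulrAC ler_wpM2r// -(ler_pM2l c0).
  apply: le_trans (_ : (c - 1) * (a + t ^+ 2 * g) <= _).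
    by rewrite mulrA [c * d]mulrC ler_wpM2r// addr_ge0.
  have -> : c * a = (c - 1) * a + a by ring.
  rewrite mulrDr lerD2l.
  have : t ^+ 2 * ((c - 1) * g) <= a - b.
    rewrite -tE' ler_wpM2l ?exprn_ge0// mulrBl mul1r lerD2r.
    exact: cg.
  rewrite mulrCA => /le_trans; apply.
  by rewrite gerBl.
- move=> Bv0; move: normE; rewrite Bv0 normr0 expr0n/= => /esym/eqP.
  by rewrite paddr_eq0// => /andP[/eqP].
Qed.

Lemma admissible_step M c d B x : 1 < c -> 1 <= M -> 0 <= d -> d * M <= 1 ->
  d * c <= c - 1 -> admissible M c B ->
  exists P B' : {linear V -> V}, [/\ orth_projection ip P, admissible M c B',
    forall z, B' z = B z - P z & ip (B' x) x <= (1 - d) * ip (B x) x].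
Proof.
move=> c1 M1 d0 dM dc adm.
have [v [v1 v2 v3]] := exists_direction _ _ _ _ x c1 M1 d0 dM dc adm.
have [P PE Porth] := line_proj_orth (B v).
pose B' : {linear V -> V} := B \- P.
exists P, B'; split=> //; first exact: admissible_sub adm v1 PE Porth _.
rewrite /B'/= ipBl PE ip_line_proj mulrBl mul1r.
have [Bsa _] := adm_pos _ _ _ adm.
rewrite -Bsa lerD2l lerN2.
have [Bv0|Bv0] := eqVneq (B v) 0.
  by rewrite (v3 Bv0) mulr0 divr_ge0 ?exprn_ge0.
by rewrite ler_pdivlMr ?exprn_gt0 ?normr_gt0.
Qed.

(** * Essential norm and subspaces of finite codimension *)

(** Gram-Schmidt: each new [a] is replaced by [u = E a], whose line is removed from the range of
    [E]. The set [S] grows by a compact set of multiples of [A u]. *)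
Lemma orthogonal_complement_projection (A : {linear V -> V}) (s : seq V) :
  exists (E : {linear V -> V}) (S : set V),
    [/\ orth_projection ip E, forall z u, u \in s -> ip (E z) u = 0, compact S &
        forall x, `|x| <= 1 -> S (A (x - E x))].
Proof.
elim: s => [|a s [E [S [[Esa EE] Es cS AS]]]].
  exists (idfun : {linear V -> V}), [set 0]; split=> //; first exact: compact_set1.
  by move=> x _; rewrite /= subrr linear0.
pose u := E a; have [P PE [Psa PP]] := line_proj_orth u.
have EP x : E (P x) = P x by rewrite PE linearZ/= EE.
have PEx x : P (E x) = P x by rewrite !PE /line_proj Esa EE.
have ua : ip u a = ip u u by rewrite {3}/u -Esa EE.
have uV0 : 0 <= `|u|^-1 by rewrite invr_ge0.
have [T cT hT] := scaled_disc_compact `|u|^-1 (A u) uV0.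
pose E' : {linear V -> V} := E \- P.
exists E', [set p.1 + p.2 | p in S `*` T]; split.
- split=> [x y|x]; first by rewrite /E'/= ipBl ipBr Esa Psa.
  by rewrite /E'/= linearB linearB EE EP PEx PP subrr subr0.
- move=> z w; rewrite inE /E'/= ipBl PE ipZl => /predU1P[->|ws]; last first.
    by rewrite (Es z w ws) (Es a w ws) mulr0 subrr.
  rewrite ua Esa -/u; have [->|u0] := eqVneq u 0; first by rewrite !ip0r mulr0 subrr.
  by rewrite divfK ?subrr// ipxx expf_eq0/= normr_eq0.
- exact: compactD.
- move=> x x1; exists (A (x - E x), (ip x u / ip u u) *: A u) => /=; last first.
    by rewrite /E'/= opprB addrA addrAC PE (linearD A (x - E x)) /line_proj linearZ.
  split; first exact: AS.
  (* For [u = 0] both the coefficient and the radius are [0], since [0^-1 = 0]. *)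
  apply: hT; have [->|u0] := eqVneq u 0; first by rewrite ip0r mul0r !normr0 invr0.
  rewrite normrM normfV ipxx normrX normr_id ler_pdivrMr ?exprn_gt0 ?normr_gt0//.
  rewrite expr2 mulKf ?normr_eq0//; apply: le_trans (cauchy_schwarz _ _) _.
  by rewrite ler_piMl.
Qed.

(** Bounds from below the set whose [inf] is [essnorm]. If the supremum does not exist, [sup] is [0]
    by convention. *)
Lemma opnorm0_le (B : {linear V -> V}) : 0 <= opnorm emb B.
Proof.
rewrite /opnorm; set S := [set _ | _].
have S0 : S 0 by exists 0; rewrite normr0 linear0 normr0 rmorph0.
have [hS|/sup_out->//] := pselect (has_sup S).
by apply: sup_upper_bound.
Qed.

(** [T = A (1 - E)] is compact and [A - T = A E], so [|A E x| > r] for some [x] in the unit ball;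
    [y = E x] also lies in that ball. *)
Lemma essnorm_large (A : {linear V -> V}) (r : R) : 0 <= r -> r < essnorm emb A ->
  forall s : seq V, exists2 y, (forall u, u \in s -> ip y u = 0) & emb r * `|y| < `|A y|.
Proof.
move=> r0 rA s.
have [E [S [[Esa EE] Es cS AS]]] := orthogonal_complement_projection A s.
pose T : {linear V -> V} := A \- (A \o E).
have TE x : T x = A (x - E x) by rewrite linearB.
have cT : compact_op T.
  apply: (subclosed_compact _ cS); first exact: closed_closure.
  rewrite [X in _ `<=` X](closure_id S).1; last exact: compact_closed (@norm_hausdorff _ V) cS.
  by apply: closure_subset => _ [x x1 <-]; rewrite TE; exact: AS.
have : essnorm emb A <= opnorm emb (fun x => A x - T x).
  apply: ge_inf; last by exists T.
  by exists 0 => _ [U _ <-]; exact: (opnorm0_le (A \- U)).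
move/(lt_le_trans rA) => /sup_gt[].
  by exists 0, 0; rewrite normr0 TE (linear0 E) subr0 linear0 subr0 normr0 rmorph0.
move=> t [x [x1 tx]] rt; exists (E x); first exact: Es.
have Ex1 : `|E x| <= 1.
  have [->|Ex0] := eqVneq (E x) 0; first by rewrite normr0.
  rewrite -(@ler_pM2r _ `|E x|) ?normr_gt0// mul1r -expr2 -ipxx Esa EE.
  rewrite -[leLHS]ger0_norm; last by rewrite -(EE x) -Esa ipxx exprn_ge0.
  by apply: le_trans (cauchy_schwarz _ _) _; rewrite ler_piMl.
have -> : A (E x) = A x - T x by rewrite TE linearB opprB addrC subrK.
rewrite -tx; apply: le_lt_trans (_ : emb r < _); last by rewrite emb_lt.
by rewrite ler_piMr// emb_ge0.
Qed.

(** * Iteration and strong convergence *)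

Lemma admissible_decomposition M c (A : {linear V -> V}) :
  separable V -> 1 < c -> 1 <= M -> admissible M c A ->
  exists P : nat -> {linear V -> V}, (forall i, orth_projection ip (P i)) /\
    forall x, (fun n => \sum_(i < n) P i x) @ \oo --> A x.
Proof.
move=> [f fdense] c1 M1 admA.
have c0 : 0 < c by exact: lt_trans c1.
have M0 : 0 < M by exact: lt_le_trans M1.
(* From [d c M = c - 1] follow [d c <= c - 1], as [M >= 1], and [d M <= 1], as [c - 1 <= c]. *)
pose d := (c - 1) / (c * M); pose q := 1 - d.
have d0 : 0 < d by rewrite divr_gt0 ?mulr_gt0 ?subr_gt0.
have dcM : d * (c * M) = c - 1 by rewrite divfK// gt_eqF// mulr_gt0.
have dc : d * c <= c - 1 by rewrite -dcM mulrA ler_peMr// mulr_ge0// ltW.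
have dM : d * M <= 1.
  by rewrite -(ler_pM2l c0) mulrCA dcM mulr1 gerBl.
have d1 : d <= 1 by apply: le_trans dM; rewrite ler_peMr// ltW.
have q0 : 0 <= q by rewrite subr_ge0.
have q1 : q < 1 by rewrite ltrBlDr ltrDl.
(* Stage [n] treats the dense vector of index [logn 2 n.+1], so that the [j]-th
   one is treated at the stages [2 ^ j * (2 k + 1) - 1]. *)
pose target n := f (logn 2 n.+1).
(* Carrying admissibility in the state lets one choice function drive the whole recursion. *)
have step (p : {B | admissible M c B} * nat) :
    exists r : {linear V -> V} * {B | admissible M c B},
    [/\ orth_projection ip r.1, forall z, sval r.2 z = sval p.1 z - r.1 z &
      ip (sval r.2 (target p.2)) (target p.2) <=
      q * ip (sval p.1 (target p.2)) (target p.2)].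
  have [P [B' [Porth admB' B'E B'x]]] :=
    admissible_step M c d (sval p.1) (target p.2) c1 M1 (ltW d0) dM dc (svalP p.1).
  by exists (P, exist _ B' admB').
have [g gP] := choice step.
pose B := fix B n := if n is m.+1 then (g (B m, m)).2 else exist _ A admA.
pose P n := (g (B n, n)).1.
have Porth n : orth_projection ip (P n) by have [] := gP (B n, n).
exists P; split=> // z.
have BS n y : sval (B n.+1) y = sval (B n) y - P n y by have [] := gP (B n, n).
have sumE n y : \sum_(i < n) P i y = A y - sval (B n) y.
  elim: n => [|n IH]; first by rewrite big_ord0 subrr.
  by rewrite big_ord_recr/= IH BS opprB addrA addrAC.
pose form n y := ip (sval (B n) y) y.
have form_ge0 n y : 0 <= form n y by have [[_ +] _ _] := svalP (B n); apply.
have form_decr y : {homo form^~ y : m n / (m <= n)%N >-> n <= m}.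
  apply: homo_leq => [n|a b e ab be|n]; [exact: lexx|exact: le_trans be ab|].
  have [Psa PP] := Porth n.
  by rewrite /form BS ipBl gerBl -PP Psa ipxx exprn_ge0.
have form_target n : (0 < n)%N -> form n (target n.-1) <= q * form n.-1 (target n.-1).
  by case: n => // n _; have [] := gP (B n, n).
(* [B n] has passed the stages below [n], so this index comes just after a treatment of [f j]. The
   case [k = 0] uses monotonicity alone, hence [q ^+ k]. *)
have form_geo j k : form (2 ^ j * k.*2.+1)%N (f j) <= q ^+ k * form 0%N (f j).
  elim: k => [|k IH]; first by rewrite expr0 mul1r form_decr.
  have N0 : (0 < 2 ^ j * k.+1.*2.+1)%N by rewrite muln_gt0 expn_gt0.
  have tE : target (2 ^ j * k.+1.*2.+1).-1 = f j.
    rewrite /target prednK// lognM ?expn_gt0// pfactorK// [X in (_ + X)%N]lognE.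
    by rewrite dvdn2/= odd_double addn0.
  apply: le_trans (_ : q * form (2 ^ j * k.+1.*2.+1).-1 (f j) <= _).
    by rewrite -tE form_target.
  rewrite exprS -mulrA ler_wpM2l//; apply: le_trans IH.
  apply: form_decr; rewrite -ltnS prednK// ltn_pmul2l ?expn_gt0// ltnS ltn_double.
apply/cvgrPdist_lt => e e0.
have e2 : 0 < e / 2 by rewrite divr_gt0.
have [j zj] : exists j, `|z - f j| < e / 2 / M.
  have : closure (range f) z by rewrite fdense.
  move=> /(_ _ (nbhsx_ballx z (e / 2 / M) (divr_gt0 e2 M0)))[_ [[j _ <-]]].
  by rewrite -ball_normE; exists j.
(* The [+ 1] keeps the divisor positive when the form vanishes at [f j]. *)
have F0 : 0 < M * (form 0%N (f j) + 1) by rewrite mulr_gt0// ltr_wpDl.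
have [k qk] := scalar_expr_small q _ (introT andP (conj q0 q1)) (divr_gt0 (exprn_gt0 2 e2) F0).
exists (2 ^ j * k.*2.+1)%N => // n /= Nn.
rewrite sumE opprB addrC subrK -(subrK (f j) z) linearD.
apply: le_lt_trans (ler_normD _ _) _; rewrite [e]splitr ltrD//.
  apply: le_lt_trans (adm_lipschitz _ _ _ _ (ltW M0) (svalP (B n))) _.
  by rewrite mulrC -ltr_pdivlMr.
rewrite -(@ltr_pXn2r _ 2)// ?nnegrE ?(ltW e2)//.
apply: le_lt_trans (adm_norm _ _ _ _ (ltW M0) (svalP (B n))) _.
move: qk; rewrite ltr_pdivlMr// => /(le_lt_trans _); apply.
rewrite mulrCA ler_wpM2l ?(ltW M0)//.
apply: le_trans (form_decr _ _ _ Nn) _; apply: le_trans (form_geo _ _) _.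
by rewrite ler_wpM2l ?exprn_ge0// lerDl.
Qed.

Lemma bounded_admissible (A : {linear V -> V}) : bounded_op A -> positive_op ip A ->
  1 < essnorm emb A -> exists M c, [/\ 1 < c, 1 <= M & admissible M c A].
Proof.
move=> [M AM] Apos A1; set c0 := (1 + essnorm emb A) / 2.
have c01 : 1 < c0 by rewrite /c0; lra.
have c0A : c0 < essnorm emb A by rewrite /c0; lra.
have large := essnorm_large A _ (ltW (lt_trans ltr01 c01)) c0A.
have c1 : 1 < emb c0 by rewrite -(rmorph1 emb) emb_lt.
(* Such a [y] is nonzero, and [|A y| <= M |y|] then forces [M > c]. *)
have [y _ yc] := large [::].
have y0 : 0 < `|y|.
  by rewrite normr_gt0; apply: contraTneq yc => ->; rewrite linear0 normr0 mulr0 ltxx.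
have cM : emb c0 < M by rewrite -(ltr_pM2r y0); exact: lt_le_trans (AM y).
exists M, (emb c0); split=> //; first exact: ltW (lt_trans c1 cM).
split=> // x; have [_ Ax] := Apos; rewrite -(ger0_norm (Ax x)).
apply: le_trans (cauchy_schwarz _ _) _.
by rewrite expr2 mulrA ler_wpM2r.
Qed.

End Scalars.

(** * Real and complex scalars *)

(** The infinite alternative is the one proved; zero projections may occur among its terms. *)
Lemma theorem2_for_scalars (R : realType) (K : numFieldType)
    (emb : {rmorphism R -> K}) (cj : {rmorphism K -> K}) :
  {mono emb : r s / r <= s} ->
  (forall a : K, 0 <= a -> exists r, emb r = a) ->
  (forall a : K, a * cj a = `|a| ^+ 2) ->
  (exists i : K, forall (M : R) (a : K), `|a| <= emb M ->
    exists r s : R, [/\ `|r| <= M, `|s| <= M & a = emb r + emb s * i]) ->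
  forall V : completeNormedModType K, theorem2_for emb cj V.
Proof.
move=> emb_le emb_onto cjE emb_span V ip ipP sepV _ A Ab Ap A1; right.
have [M [c [c1 M1 admA]]] :=
  bounded_admissible R K emb cj emb_le emb_onto cjE emb_span V ip ipP A Ab Ap A1.
exact: (admissible_decomposition R K emb cj emb_le emb_onto cjE V ip ipP M c).
Qed.

(* Real case (K = R, conj = id) and complex case (K = R[i], conj = complex conjugation). *)
Theorem theorem2 (R : realType) :
  (forall V : completeNormedModType R,
     theorem2_for (fun r : R => r) (fun z : R => z) V)
  /\
  (forall V : completeNormedModType R[i],
     theorem2_for (@real_to_complex R) (fun z : R[i] => z^*) V).
Proof.
split.
- apply: (theorem2_for_scalars R R idfun idfun) => //.
  + by move=> a a0; exists a.
  + by move=> a; rewrite real_normK ?num_real// expr2.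
  + exists 0 => M a aM; exists a, 0; split=> //=; last by rewrite mulr0 addr0.
    by rewrite normr0 (le_trans _ aM).
- apply: (theorem2_for_scalars R R[i] (real_complex R) Num.conj).
  + exact: lecR.
  + by move=> a a0; exists (complex.Re a); exact: RRe_real (ger0_real a0).
  + by move=> a; rewrite normCK.
  + exists 'i%C => M a aM; exists (complex.Re a), (complex.Im a); split.
    * by rewrite -lecR (le_trans (normc_ge_Re _)).
    * rewrite -lecR; apply: le_trans aM; rewrite normc_def lecR.
      by rewrite -sqrtr_sqr ler_wsqrtr// lerDr sqr_ge0.
    * by rewrite [LHS]complexE mulrC.
Qed.
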